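(* Let $n$ be a positive integer and let $M \in M_n(\mathbb D)$ be a square dual-numbered matrix. Then there exist matrices $U, \Sigma, V \in M_n(\mathbb D)$ such that $$M = U\Sigma \overline V^T,$$ where $U\overline U^T = V\overline V^T = I$, and $\Sigma$ is a block-diagonal matrix in which each diagonal block is of one of the forms $$\begin{pmatrix}\sigma_i\end{pmatrix},\qquad \begin{pmatrix}\sigma_i & -\epsilon \sigma'_i \\ \epsilon\sigma_i' & \sigma_i\end{pmatrix},\qquad \begin{pmatrix} \epsilon\sigma_i'\end{pmatrix},$$ where each $\sigma_i$ and each $\sigma_i'$ is a real number, and each $\sigma_i' \neq 0$.
   Context: The dual numbers are the commutative ring $\mathbb D = \mathbb R[\epsilon]/(\epsilon^2)$; every element is uniquely of the form $a+b\epsilon$ with $a,b\in\mathbb R$, and $\epsilon^2=0$. Conjugation is $\overline{a+b\epsilon} = a-b\epsilon$, applied entrywise to matrices; $\overline V^T$ is the transpose of the entrywise conjugate of $V$. $M_n(\mathbb D)$ is the ring of $n\times n$ matrices over $\mathbb D$. A real number $a$ is identified with the dual number $a+0\epsilon$. *)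

(* Defs.v *)
From HB Require Import structures.
From mathcomp Require Import all_boot all_order all_algebra.
From mathcomp Require Import reals.

Set Implicit Arguments.
Unset Strict Implicit.
Unset Printing Implicit Defensive.

Import Order.TTheory GRing.Theory Num.Theory.
Local Open Scope ring_scope.

(* Elements of the quotient ring R[X]/(X^2) are represented by their normal
   forms, the polynomials of size at most 2, so that x`_0 and x`_1 are the
   coefficients a and b of x = a + b eps. *)
Definition dual (R : realType) : Type := {poly %/ ('X^2 : {poly R})}.

#[warnings="-redundant-canonical-projection"]
HB.instance Definition _ (R : realType) :=
  GRing.ComNzRing.copy (dual R) {poly %/ ('X^2 : {poly R})}.

Definition dreal (R : realType) (a : R) : dual R := qpolyC 'X^2 a.

Notation "a %:D" := (dreal a) (at level 1, format "a %:D") : ring_scope.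

Definition eps {R : realType} : dual R := 'qX.

Definition dconj (R : realType) (x : dual R) : dual R :=
  (x`_0)%:D - (x`_1)%:D * eps.

Definition dconjmx (R : realType) (m n : nat) (A : 'M[dual R]_(m, n)) :
    'M[dual R]_(m, n) :=
  map_mx (@dconj R) A.

(* The blocks are consecutive square diagonal blocks, in any number and order,
   each satisfying P; the cast identifies the sum of their sizes with n. *)
Definition block_diagonal (K : nmodType) (P : forall m : nat, 'M[K]_m -> Prop)
    (n : nat) (A : 'M[K]_n) : Prop :=
  exists (k : nat) (p : 'I_k -> nat) (B : forall i : 'I_k, 'M[K]_(p i))
         (e : (\sum_(i < k) p i)%N = n),
    (forall i : 'I_k, P (p i) (B i)) /\
    A = castmx (e, e) (\mxdiag_(i < k) B i).

Inductive svd_block (R : realType) : forall m : nat, 'M[dual R]_m -> Prop :=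
| SvdReal (s : R) :
    svd_block (s%:D%:M : 'M[dual R]_1)
| SvdTwin (s s' : R) : s' != 0 ->
    svd_block (block_mx s%:D%:M          (- (eps * s'%:D))%:M
                        (eps * s'%:D)%:M s%:D%:M : 'M[dual R]_(1 + 1))
| SvdEps (s' : R) : s' != 0 ->
    svd_block ((eps * s'%:D)%:M : 'M[dual R]_1).

Section DualTheory.

Variable R : realType.
Implicit Types (a b : R) (x y : dual R).

Lemma poly_eps : (eps : dual R) = 'X :> {poly R}.
Proof. by rewrite /eps qpolyXE ?size_polyXn ?monicXn. Qed.

Lemma poly_dualM x y : x * y = Pdiv.Ring.rmodp ((x : {poly R}) * y) 'X^2 :> {poly R}.
Proof. exact: (congr1 (Pdiv.Ring.rmodp _) (mk_monic_Xn R 2)). Qed.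

Lemma eps_sqr : (eps : dual R) * eps = 0.
Proof.
apply: val_inj; rewrite [LHS]poly_dualM poly_eps -expr2.
by rewrite Pdiv.RingMonic.rmodpp ?monicXn.
Qed.

Lemma dual_eqP x y : x`_0 = y`_0 -> x`_1 = y`_1 -> x = y.
Proof.
move=> e0 e1; apply/npolyP => -[|[|i]] //.
by rewrite !big_coef_npoly // mk_monic_Xn size_polyXn.
Qed.

Lemma poly_dual a b : a%:D + b%:D * eps = a%:P + b *: 'X :> {poly R}.
Proof.
rewrite poly_of_qpolyD [in LHS]poly_dualM poly_eps qpolyCE mul_polyC.
rewrite Pdiv.CommonRing.rmodp_small // size_polyXn.
by rewrite (leq_ltn_trans (size_scale_leq _ _)) // size_polyX.
Qed.

Lemma dual_coef0 a b : (a%:D + b%:D * eps)`_0 = a.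
Proof. by rewrite poly_dual coefD coefC coefZ coefX mulr0 addr0. Qed.

Lemma dual_coef1 a b : (a%:D + b%:D * eps)`_1 = b.
Proof. by rewrite poly_dual coefD coefC coefZ coefX mulr1 add0r. Qed.

Lemma dualE x : x = (x`_0)%:D + (x`_1)%:D * eps.
Proof. by apply: dual_eqP; rewrite ?dual_coef0 ?dual_coef1. Qed.

Lemma dconjE a b : dconj (a%:D + b%:D * eps) = a%:D - b%:D * eps.
Proof. by rewrite /dconj dual_coef0 dual_coef1. Qed.

End DualTheory.

(* Main.v *)
From HB Require Import structures.
Require Import Defs.
From mathcomp Require Import all_boot all_order all_algebra.
From mathcomp Require Import reals boolp.
From mathcomp Require Import complex.

(** Write [M = A + B eps] with [A], [B] real. For symmetric [K] and [L], the
    matrices [1 + K eps] and [1 + L eps] are unitary, and multiplying [M] by the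
    first on the left and by the conjugate transpose of the second on the right
    replaces [B] by [B + K A - A L]. Projecting [B] orthogonally away from all
    these [K A - A L] makes [A^T B] and [A B^T] antisymmetric, a condition
    invariant under real orthogonal changes of basis on both sides. Then [A^T A]
    and [B^T B] commute, and a common eigenvector, taken in the row space of [A]
    when [A] is nonzero, gives one or two pairs of orthonormal vectors that split
    off a diagonal block; induction on [n] finishes the proof. *)

Set Implicit Arguments.
Unset Strict Implicit.
Unset Printing Implicit Defensive.

Import Order.TTheory GRing.Theory Num.Theory.
Local Open Scope ring_scope.

(** * Spectral theory of real symmetric matrices and orthonormal bases *)

Lemma mxtrace_mul_tr_eq0 (R : realDomainType) (m n : nat) (X : 'M[R]_(m, n)) :
  \tr (X *m X^T) = 0 -> X = 0.
Proof.
have trE i : (X *m X^T) i i = \sum_j X i j ^+ 2.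
  by rewrite mxE; apply: eq_bigr => j _; rewrite mxE expr2.
rewrite /mxtrace; under eq_bigr do rewrite trE.
rewrite pair_bigA /= => /eqP; rewrite psumr_eq0 => [|[i j] _]; last exact: sqr_ge0.
move=> /allP X0; apply/matrixP=> i j; rewrite mxE; apply/eqP.
by have := X0 (i, j); rewrite mem_index_enum sqrf_eq0; apply.
Qed.

Lemma mulmx_tr_eq0 (R : realDomainType) (m n : nat) (X : 'M[R]_(m, n)) :
  X *m X^T = 0 -> X = 0.
Proof. by move=> XX0; apply: mxtrace_mul_tr_eq0; rewrite XX0 mxtrace0. Qed.

(** The restriction of [T] to the row space of [W] has an eigenvalue over the complex extension of
    [R]. Symmetry of [T] forces it to be real, so it is a root of the real characteristic polynomial
    and has an eigenvector over [R]. *)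
Lemma symmetric_eigenvector (R : rcfType) (m n : nat) (T : 'M[R]_n)
    (W : 'M[R]_(m, n)) :
    T^T = T -> W != 0 -> (W *m T <= W)%MS ->
  exists (v : 'rV[R]_n) (a : R), [/\ v != 0, (v <= W)%MS & v *m T = a *: v].
Proof.
move=> symT W0 WT.
(* A free family of rows makes the matrix [X] of the restriction square and sends nonzero coordinate
   vectors to nonzero vectors. *)
set W' := row_base W.
have : (W' *m T <= W')%MS.
  by rewrite (eqmxMr _ (eq_row_base W)) eq_row_base.
case/submxP=> X WX.
have r0 : (0 < \rank W)%N by rewrite lt0n mxrank_eq0.
have [c] := eigenvalue_closed (map_mx (real_complex R) X) r0.
move=> cX.
have /complex_realP[a ca] : c \is Num.real.
  have /eigenvalueP[y yX y0] := cX.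
  set u := y *m map_mx (real_complex R) W'.
  have uT : u *m map_mx (real_complex R) T = c *: u.
    by rewrite /u -mulmxA -map_mxM WX map_mxM mulmxA yX scalemxAl.
  have u0 : u != 0.
    rewrite /u -mxrank_eq0 mxrankMfree ?mxrank_eq0 //.
    by rewrite row_free_map row_base_free.
  (* The entry of [N] is the squared Hermitian norm of [u]. Inserting [T] between the two factors
     and letting it act on either side gives [c *: N = c^* *: N]. *)
  clearbody u; pose N := u *m (map_mx Num.conj u)^T.
  have N0 : N 0 0 != 0.
    have -> : N 0 0 = \sum_j `|u 0 j| ^+ 2.
      by rewrite mxE; apply: eq_bigr => j _; rewrite normCK !mxE.
    apply: contra u0; rewrite psumr_eq0 => [|k _]; last by rewrite exprn_ge0.
    move/allP=> h; apply/eqP/rowP=> j; rewrite mxE.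
    have := h j; rewrite mem_index_enum sqrf_eq0 normr_eq0.
    by move=> /(_ isT) /eqP.
  have conjT : map_mx Num.conj (map_mx (real_complex R) T)
      = map_mx (real_complex R) T.
    apply/matrixP=> i j; rewrite !mxE; apply: CrealP.
    by apply/complex_realP; exists (T i j).
  have uT' : map_mx (real_complex R) T *m (map_mx Num.conj u)^T
       = c^* *: (map_mx Num.conj u)^T.
    apply: trmx_inj.
    rewrite trmx_mul trmxK [(map_mx _ T)^T]map_trmx symT -conjT -map_mxM uT.
    by apply/matrixP=> i j; rewrite !mxE rmorphM.
  have : c *: N = c^* *: N.
    by rewrite scalemxAl -uT -mulmxA uT' -scalemxAr.
  clearbody N; move/matrixP/(_ 0 0); rewrite !mxE => cc.
  by apply/CrealP/esym; exact: mulIf N0 _ _ cc.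
have /eigenvalueP[y yX y0] : eigenvalue X a.
  move: cX; rewrite !eigenvalue_root_char -map_char_poly ca.
  by rewrite fmorph_root.
exists (y *m W'), a; split.
- rewrite -mxrank_eq0 mxrankMfree ?mxrank_eq0 //.
  by rewrite row_base_free.
- by rewrite -(eq_row_base W) submxMl.
- by rewrite -mulmxA WX mulmxA yX scalemxAl.
Qed.

(** Since [S] and [T] commute, [T] preserves the intersection of [W] with an eigenspace of [S]; an
    eigenvector of [T] found there serves both. *)
Lemma symmetric_common_eigenvector (R : rcfType) (m n : nat) (S T : 'M[R]_n)
    (W : 'M[R]_(m, n)) :
    S^T = S -> T^T = T -> S *m T = T *m S ->
    W != 0 -> (W *m S <= W)%MS -> (W *m T <= W)%MS ->
  exists (v : 'rV[R]_n) (a b : R),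
    [/\ v != 0, (v <= W)%MS, v *m S = a *: v & v *m T = b *: v].
Proof.
move=> symS symT ST W0 WS WT.
have [v [a [v0 vW va]]] := symmetric_eigenvector symS W0 WS.
pose E := (eigenspace S a :&: W)%MS.
have vE : (v <= E)%MS by rewrite sub_capmx vW andbT; apply/eigenspaceP.
have E0 : E != 0.
  by apply: contraNneq v0 => E0; move: vE; rewrite E0 submx0.
have ET : (E *m T <= E)%MS.
  rewrite sub_capmx; apply/andP; split.
    apply/eigenspaceP; rewrite -mulmxA -ST mulmxA.
    have /eigenspaceP -> : (E <= eigenspace S a)%MS by exact: capmxSl.
    by rewrite scalemxAl.
  by apply: submx_trans WT; rewrite submxMr // capmxSr.
have [w [b [w0 wE wb]]] := symmetric_eigenvector symT E0 ET.
exists w, a, b; split=> //.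
  by apply: submx_trans wE (capmxSr _ _).
by apply/eigenspaceP; apply: submx_trans wE (capmxSl _ _).
Qed.

Lemma unit_scale (R : rcfType) (n : nat) (v : 'rV[R]_n) : v != 0 ->
  exists2 c : R, c != 0 & (c *: v) *m (c *: v)^T = 1%:M.
Proof.
move=> v0; pose N := (v *m v^T) 0 0.
have NE : v *m v^T = N%:M by rewrite [LHS]mx11_scalar.
have N_ge0 : 0 <= N.
  by rewrite /N mxE; apply: sumr_ge0 => i _; rewrite mxE -expr2 sqr_ge0.
have N0 : N != 0.
  apply: contraNneq v0 => N0; apply/eqP/mulmx_tr_eq0.
  by rewrite NE N0 raddf0.
exists (Num.sqrt N)^-1; first by rewrite invr_eq0 sqrtr_eq0 -ltNge lt_def N0.
rewrite linearZ /= -scalemxAl -scalemxAr NE scalerA -invfM -expr2 sqr_sqrtr //.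
by rewrite scale_scalar_mx mulVf.
Qed.

(** One row is added at a time: while [u] has fewer than [n] rows, [kermx u^T] contains a nonzero
    vector, which is normalized and appended. *)
Lemma orthonormal_completion (R : rcfType) (m p n : nat) (u : 'M[R]_(p, n)) :
    (p + m = n)%N -> u *m u^T = 1%:M ->
  exists w : 'M[R]_(m, n), w *m w^T = 1%:M /\ u *m w^T = 0.
Proof.
elim: m p u => [|m IH] p u pmn uu.
  by exists 0; split; apply/matrixP=> ? [].
have /rowV0Pn[v /sub_kermxP vu v0] : kermx u^T != 0.
  rewrite -mxrank_eq0 mxrank_ker subn_eq0 -ltnNge.
  by rewrite (leq_ltn_trans (rank_leq_col _)) // -pmn addnS ltnS leq_addr.
have [c c0 cv] := unit_scale v0.
set e := c *: v in cv.
have eu : e *m u^T = 0 by rewrite -scalemxAl vu scaler0.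
have ue : u *m e^T = 0 by rewrite -[u]trmxK -trmx_mul eu trmx0.
have [||w [ww uw]] := IH (p + 1)%N (col_mx u e).
- by rewrite -addnA.
- by rewrite tr_col_mx mul_col_row uu cv eu ue -scalar_mx_block.
move: uw; rewrite mul_col_mx => /(congr1 (fun X => (usubmx X, dsubmx X))).
rewrite col_mxKu col_mxKd !linear0 => -[uw ew].
have we : w *m e^T = 0 by rewrite -[w]trmxK -trmx_mul ew trmx0.
suff: col_mx e w *m (col_mx e w)^T = 1%:M /\ u *m (col_mx e w)^T = 0.
  by exists (col_mx e w).
rewrite tr_col_mx; split.
  by rewrite mul_col_row cv ww ew we -scalar_mx_block.
by rewrite mul_mx_row ue uw row_mx0.
Qed.

(** * Orthogonal projection for the trace form *)

Lemma orthogonal_projection (R : realFieldType) (m n : nat) (W : 'M[R]_(m, n))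
    (b : 'rV[R]_n) :
  exists z : 'rV[R]_m, (b + z *m W) *m W^T = 0.
Proof.
have : (b *m W^T <= W *m W^T)%MS.
  (* The normal equations are solvable: [C] is annihilated by [W *m W^T], so
     [(W^T *m C)^T *m (W^T *m C) = 0] and hence [W^T *m C = 0]. *)
  rewrite submxE -mulmxA; set C := cokermx _.
  suff -> : W^T *m C = 0 by rewrite mulmx0.
  apply: trmx_inj; rewrite trmx0; apply: mulmx_tr_eq0.
  by rewrite trmxK trmx_mul trmxK -mulmxA (mulmxA W) mulmx_coker mulmx0.
case/submxP=> z bz; exists (- z).
by rewrite mulmxDl bz -mulmxA mulNmx subrr.
Qed.

(** Lets [orthogonal_projection], a statement on row vectors, be applied to spaces of matrices. *)
Lemma mxvec_dot (R : comNzRingType) (m n : nat) (X Y : 'M[R]_(m, n)) :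
  mxvec X *m (mxvec Y)^T = (\tr (X *m Y^T))%:M.
Proof.
rewrite [LHS]mx11_scalar; congr (_%:M); rewrite mxE /mxtrace.
rewrite (reindex _ (curry_mxvec_bij _ _)) /=.
rewrite [RHS](_ : _ = \sum_i \sum_j X i j * Y i j).
  by rewrite pair_bigA; apply: eq_bigr => -[i j] _; rewrite mxE !mxvecE.
by apply: eq_bigr => i _; rewrite mxE; apply: eq_bigr => j _; rewrite mxE.
Qed.

(** Testing against [H = G + G^T] itself shows that [G], and by transposition [G^T], is orthogonal
    to [H]; so [H] is orthogonal to itself. *)
Lemma antisymmetric_of_trace (R : realDomainType) (n : nat) (G : 'M[R]_n) :
  (forall Z : 'M[R]_n, \tr (G *m (Z + Z^T)) = 0) -> G = - G^T.
Proof.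
move=> trG; apply/eqP; rewrite -addr_eq0; apply/eqP.
set H := G + G^T.
have HT : H^T = H by rewrite linearD /= trmxK addrC.
have GH : \tr (G *m H) = 0.
  have := trG H; rewrite HT mulmxDr mxtraceD => /eqP.
  by rewrite -mulr2n mulrn_eq0 => /eqP.
apply: mxtrace_mul_tr_eq0; rewrite HT {1}/H mulmxDl mxtraceD GH add0r.
by rewrite -mxtrace_tr trmx_mul trmxK HT mxtrace_mulC.
Qed.

(* The orthogonal complement of the matrices [K *m A - A *m L] with [K], [L]
   symmetric consists of the [C] with [A *m C^T] and [A^T *m C] antisymmetric. *)
Lemma symmetric_reduction (R : realFieldType) (n : nat) (A B : 'M[R]_n) :
  exists K L : 'M[R]_n, let C := B + K *m A - A *m L in
    [/\ K^T = K, L^T = L, A^T *m C = - (C^T *m A) & A *m C^T = - (C *m A^T)].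
Proof.
(* Symmetrizing an arbitrary matrix makes [K *m A] and [A *m L] linear images of the full matrix
   space. Stacking the matrices of [f] and [g] lets one projection handle both. *)
pose f := mulmxr A \o (@idfun 'M[R]_n \+ @trmx R n n).
pose g := mulmx A \o (@idfun 'M[R]_n \+ @trmx R n n).
have [z] := orthogonal_projection (col_mx (lin_mx f) (lin_mx g)) (mxvec B).
pose X := vec_mx (lsubmx z); pose Y := vec_mx (rsubmx z).
have -> : z *m col_mx (lin_mx f) (lin_mx g) = mxvec (f X) + mxvec (g Y).
  by rewrite -[z]hsubmxK mul_row_col !mul_rV_lin.
rewrite -!linearD /=.
set C := B + _.
rewrite tr_col_mx mul_mx_row => /(congr1 (fun X => (lsubmx X, rsubmx X))).
rewrite row_mxKl row_mxKr !linear0 => -[Cf Cg].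
have trf Z : \tr (C *m (f Z)^T) = 0.
  have : mxvec C *m (mxvec Z *m lin_mx f)^T = 0.
    by rewrite trmx_mul mulmxA Cf mul0mx.
  rewrite mul_vec_lin mxvec_dot => /matrixP/(_ 0 0).
  by rewrite !mxE eqxx mulr1n.
have trg Z : \tr (C *m (g Z)^T) = 0.
  have : mxvec C *m (mxvec Z *m lin_mx g)^T = 0.
    by rewrite trmx_mul mulmxA Cg mul0mx.
  rewrite mul_vec_lin mxvec_dot => /matrixP/(_ 0 0).
  by rewrite !mxE eqxx mulr1n.
(* The sign turns the summand [g Y] of the projection into [- A *m L]. *)
exists (X + X^T), (- (Y + Y^T)).
rewrite mulmxN opprK -addrA -/(f X) -/(g Y) -[_ + (f X + g Y)]/C /=.
split.
- by rewrite linearD /= trmxK addrC.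
- by rewrite linearN linearD /= trmxK addrC.
- rewrite [LHS]antisymmetric_of_trace ?trmx_mul ?trmxK // => Z.
  rewrite -mulmxA mxtrace_mulC -mulmxA -[RHS](trg Z) [(g Z)^T]trmx_mul.
  by rewrite [(_ + _)^T]linearD /= trmxK [Z^T + Z]addrC.
- apply/eqP; rewrite -eqr_oppLR eq_sym; apply/eqP.
  rewrite [LHS]antisymmetric_of_trace ?trmx_mul ?trmxK // => Z.
  by rewrite -mulmxA -[RHS](trf Z) [(f Z)^T]trmx_mul [(_ + _)^T]linearD /= trmxK addrC.
Qed.

(* Equivalently, [M^T *m M] and [M *m M^T] are real for [M = A + B eps]. *)
Definition co_antisymmetric (R : realFieldType) (n : nat) (A B : 'M[R]_n) :=
  A^T *m B = - (B^T *m A) /\ A *m B^T = - (B *m A^T).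

(** * Singular vectors and the choice of a block *)

Lemma gram_eigenvector_ker (R : realFieldType) (m n : nat) (A : 'M[R]_(m, n))
    (v : 'rV[R]_n) :
  v *m (A^T *m A) = 0 -> v *m A^T = 0.
Proof.
move=> va; apply: mulmx_tr_eq0.
by rewrite trmx_mul trmxK mulmxA -[v *m _ *m _]mulmxA va mul0mx.
Qed.

(** If [a = 0] then [v *m A^T = 0], and [v = z *m A] makes [v] orthogonal to itself. *)
Lemma gram_eigenvector_neq0 (R : realFieldType) (m n : nat) (A : 'M[R]_(m, n))
    (v : 'rV[R]_n) (a : R) :
  (v <= A)%MS -> v != 0 -> v *m (A^T *m A) = a *: v -> a != 0.
Proof.
move=> /submxP[z vz] v0 va; apply: contraNneq v0 => a0.
have vA : v *m A^T = 0 by apply: gram_eigenvector_ker; rewrite va a0 scale0r.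
apply/eqP/mulmx_tr_eq0.
by rewrite {2}vz trmx_mul mulmxA vA mul0mx.
Qed.

(** Here [a] is the squared norm of [v *m A^T], hence positive, and [u] is that vector
    normalized. *)
Lemma singular_pair (R : rcfType) (m n : nat) (A : 'M[R]_(m, n))
    (v : 'rV[R]_n) (a : R) :
    v *m v^T = 1%:M -> v *m (A^T *m A) = a *: v -> a != 0 ->
  let s := Num.sqrt a in
  exists u : 'rV[R]_m,
    [/\ s != 0, u *m u^T = 1%:M, v *m A^T = s *: u & u *m A = s *: v].
Proof.
move=> vv va a0 s.
have a_gt0 : 0 < a.
  rewrite lt_def a0 /=.
  have : (v *m A^T) *m (v *m A^T)^T = a%:M.
    rewrite trmx_mul trmxK mulmxA -[v *m _ *m _]mulmxA va -scalemxAl vv.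
    by rewrite scalemx1.
  move/matrixP/(_ 0 0); rewrite [RHS]mxE mulr1n => <-.
  by rewrite mxE; apply: sumr_ge0 => i _; rewrite [_^T _ _]mxE -expr2 sqr_ge0.
have s0 : s != 0 by rewrite sqrtr_eq0 -ltNge.
have ss : s^-1 * a = s by rewrite -[X in _ * X]sqr_sqrtr ?ltW // expr2 mulKf.
exists (s^-1 *: (v *m A^T)); split=> //.
- rewrite linearZ /= -scalemxAl -scalemxAr trmx_mul trmxK mulmxA.
  rewrite -[v *m _ *m _]mulmxA va -scalemxAl vv scalerA scalerA.
  by rewrite ss scalemx1 mulVf.
- by rewrite scalerA divff // scale1r.
- by rewrite -scalemxAl -mulmxA va scalerA ss.
Qed.

Lemma scalar_antisym_eq0 (R : numDomainType) (c : 'M[R]_1) : c = - c^T -> c = 0.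
Proof.
rewrite [c]mx11_scalar tr_scalar_mx => /matrixP/(_ 0 0).
by rewrite !mxE mulr1n => /eqP; rewrite eq_sym eqNr => /eqP ->; rewrite raddf0.
Qed.

(** Exchanging the two inner factors turns either product into minus the square of [A^T *m B]. *)
Lemma co_antisymmetric_gram_commute (R : realFieldType) (n : nat)
    (A B : 'M[R]_n) : co_antisymmetric A B ->
  (A^T *m A) *m (B^T *m B) = (B^T *m B) *m (A^T *m A).
Proof.
case=> tAB ABt; transitivity (- ((A^T *m B) *m (A^T *m B))).
  by rewrite mulmxA -(mulmxA A^T) ABt mulmxN mulNmx !mulmxA.
have BAt : B *m A^T = - (A *m B^T) by rewrite ABt opprK.
rewrite [RHS]mulmxA -(mulmxA B^T) BAt mulmxN mulNmx.
by rewrite !tAB mulNmx mulmxN opprK !mulmxA.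
Qed.

(* A common unit eigenvector [v] of [A^T *m A] and [B^T *m B], the eigenvalue of
   [A^T *m A] being nonzero unless [A = 0], spans the domain of a block if
   [v *m B^T = 0] or [A = 0]; otherwise the domain is spanned by [v] and
   [v *m B^T *m A]. *)
Lemma exists_block (R : rcfType) (n : nat) (A B : 'M[R]_n) :
    (0 < n)%N -> co_antisymmetric A B ->
  (exists (a b : R) (u v : 'rV[R]_n),
    [/\ u *m u^T = 1%:M /\ v *m v^T = 1%:M, a = 0 \/ b = 0,
        u *m A = a *: v /\ u *m B = b *: v
      & v *m A^T = a *: u /\ v *m B^T = b *: u]) \/
  (exists (a b : R) (u w v x : 'rV[R]_n),
    [/\ [/\ b != 0, u *m u^T = 1%:M, w *m w^T = 1%:M & u *m w^T = 0],
        [/\ v *m v^T = 1%:M, x *m x^T = 1%:M & v *m x^T = 0],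
        [/\ u *m A = a *: v, w *m A = a *: x, u *m B = - b *: x & w *m B = b *: v]
      & [/\ v *m A^T = a *: u, x *m A^T = a *: w,
            v *m B^T = b *: w & x *m B^T = - b *: u]]).
Proof.
move=> n0 coAB; have [tAB ABt] := coAB.
have symS (C : 'M[R]_n) : (C^T *m C)^T = C^T *m C by rewrite trmx_mul trmxK.
have stable (C : 'M[R]_n) : (C *m (C^T *m C) <= C)%MS by rewrite mulmxA submxMl.
have [A0|A0] := eqVneq A 0.
  left; have [B0|B0] := eqVneq B 0.
    have [e e1] : exists e : 'rV[R]_n, e *m e^T = 1%:M.
      exists (delta_mx 0 (Ordinal n0)).
      by rewrite trmx_delta mul_delta_mx; apply/matrixP=> i j; rewrite !mxE !ord1.
    exists 0, 0, e, e; rewrite A0 B0 !trmx0 !mulmx0 !scale0r.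
    by split=> //; left.
  have [v0 [b [v0n v0B v0b]]] := symmetric_eigenvector (symS B) B0 (stable B).
  have [c c0 vv] := unit_scale v0n.
  have b0 := gram_eigenvector_neq0 v0B v0n v0b.
  have vb : (c *: v0) *m (B^T *m B) = b *: (c *: v0).
    by rewrite -scalemxAl v0b !scalerA mulrC.
  have [u [_ uu vBt uB]] := singular_pair vv vb b0.
  exists 0, (Num.sqrt b), u, (c *: v0).
  by rewrite A0 !trmx0 !mulmx0 !scale0r; split=> //; left.
have BAt : B *m A^T = - (A *m B^T) by rewrite ABt opprK.
have tBA : B^T *m A = - (A^T *m B) by rewrite tAB opprK.
(* The two relations give [A *m B^T *m B = - B *m A^T *m B = B *m B^T *m A]. *)
have stableB : (A *m (B^T *m B) <= A)%MS.
  rewrite mulmxA ABt mulNmx -mulmxA tAB mulmxN opprK mulmxA.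
  by rewrite submxMl.
have [v0 [a [b [v0n v0A v0a v0b]]]] :=
  symmetric_common_eigenvector (symS A) (symS B)
    (co_antisymmetric_gram_commute coAB) A0 (stable A) stableB.
have [c c0 vv] := unit_scale v0n.
have a0 := gram_eigenvector_neq0 v0A v0n v0a.
set v := c *: v0 in vv.
have va : v *m (A^T *m A) = a *: v.
  by rewrite -scalemxAl v0a !scalerA mulrC.
have vb : v *m (B^T *m B) = b *: v.
  by rewrite -scalemxAl v0b !scalerA mulrC.
clearbody v; have [u [s0 uu vAt uA]] := singular_pair vv va a0.
set s := Num.sqrt a in s0 vAt uA.
have uE : u = s^-1 *: (v *m A^T) by rewrite vAt scalerA mulVf ?scale1r.
have [b0|b0] := eqVneq b 0.
  left; exists s, 0, u, v.
  have vBt : v *m B^T = 0.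
    by apply: gram_eigenvector_ker; rewrite vb b0 scale0r.
  rewrite !scale0r; split=> //; first by right.
  split=> //; rewrite uE -scalemxAl -mulmxA tAB mulmxN mulmxA vBt mul0mx.
  by rewrite oppr0 scaler0.
right.
have [w [t0 ww vBt wB]] := singular_pair vv vb b0.
set t := Num.sqrt b in t0 vBt wB.
have wE : w = t^-1 *: (v *m B^T) by rewrite vBt scalerA mulVf ?scale1r.
(* [B^T *m A *m A^T = A^T *m A *m B^T], so [B^T] carries [v] to an eigenvector of [A *m A^T] for the
   same eigenvalue [a]; hence [x] has the same singular value [s] as [v]. *)
have wa : w *m (A^T^T *m A^T) = a *: w.
  rewrite trmxK wE -scalemxAl mulmxA -(mulmxA v) tBA mulmxN mulNmx.
  rewrite mulmxA -[_ *m B *m _]mulmxA BAt mulmxN opprK mulmxA -[v *m _ *m _]mulmxA.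
  by rewrite va -scalemxAl !scalerA mulrC.
have [x [_ xx wA xAt]] := singular_pair ww wa a0.
rewrite trmxK -/s in wA; rewrite -/s in xAt.
have xE : x = s^-1 *: (w *m A) by rewrite wA scalerA mulVf ?scale1r.
exists s, t, u, w, v, x.
have uB : u *m B = - t *: x.
  rewrite uE -scalemxAl -mulmxA tAB mulmxN mulmxA vBt -scalemxAl wA.
  by rewrite scalerN scaleNr !scalerA mulrAC mulVf ?mul1r.
have xBt : x *m B^T = - t *: u.
  rewrite xE -scalemxAl -mulmxA ABt mulmxN mulmxA wB -scalemxAl vAt.
  by rewrite scalerN scaleNr !scalerA mulrAC mulVf ?mul1r.
(* Up to scalars, this is both the inner product of [u] and [w] and that of [v] and [x]. *)
have vABv : v *m (A^T *m B) *m v^T = 0.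
  apply: scalar_antisym_eq0; rewrite {1}tAB mulmxN mulNmx.
  by rewrite !trmx_mul !trmxK !mulmxA.
split; split=> //.
  rewrite uE wE linearZ /= -scalemxAl -scalemxAr trmx_mul trmxK mulmxA.
  by rewrite -[_ *m B]mulmxA vABv !scaler0.
apply: trmx_inj; rewrite trmx_mul trmxK trmx0 xE wE -!scalemxAl -(mulmxA v) tBA.
by rewrite mulmxN mulNmx vABv oppr0 !scaler0.
Qed.

(** * Dual matrices as pairs of real matrices, and unitarity *)

#[warnings="-redundant-canonical-projection"]
HB.instance Definition _ (R : realType) :=
  GRing.isZmodMorphism.Build R (dual R) (@dreal R)
    (@qpolyC_is_zmod_morphism R 'X^2).
#[warnings="-redundant-canonical-projection"]
HB.instance Definition _ (R : realType) :=
  GRing.isMonoidMorphism.Build R (dual R) (@dreal R)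
    (@qpolyC_is_monoid_morphism R 'X^2).

Definition dualmx (R : realType) (m n : nat) (A B : 'M[R]_(m, n)) :
    'M[dual R]_(m, n) :=
  \matrix_(i, j) ((A i j)%:D + (B i j)%:D * eps).

Lemma dualmxP (R : realType) (m n : nat) (M : 'M[dual R]_(m, n)) :
  exists A B, M = dualmx A B.
Proof.
exists (\matrix_(i, j) (M i j)`_0), (\matrix_(i, j) (M i j)`_1).
by apply/matrixP=> i j; rewrite !mxE -dualE.
Qed.

Lemma dualmx_mul (R : realType) (m n p : nat) (A B : 'M[R]_(m, n))
    (C D : 'M[R]_(n, p)) :
  dualmx A B *m dualmx C D = dualmx (A *m C) (A *m D + B *m C).
Proof.
apply/matrixP=> i j; rewrite !mxE -big_split /= !rmorph_sum /= mulr_suml -big_split.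
apply: eq_bigr => k _; rewrite !mxE !rmorphD !rmorphM /=.
rewrite mulrDl !mulrDr -!addrA; congr (_ + _).
rewrite [X in _ + (_ + X)](_ : _ = 0) ?addr0; last first.
  by rewrite mulrACA eps_sqr mulr0.
by rewrite mulrDl mulrA [_ * eps * _]mulrAC.
Qed.

Lemma dualmx_tr (R : realType) (m n : nat) (A B : 'M[R]_(m, n)) :
  (dualmx A B)^T = dualmx A^T B^T.
Proof. by apply/matrixP=> i j; rewrite !mxE. Qed.

Lemma dualmx_conj (R : realType) (m n : nat) (A B : 'M[R]_(m, n)) :
  dconjmx (dualmx A B) = dualmx A (- B).
Proof. by apply/matrixP=> i j; rewrite !mxE dconjE rmorphN mulNr. Qed.

Lemma dualmx_scalar (R : realType) (n : nat) (a : R) :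
  dualmx a%:M 0 = (a%:D)%:M :> 'M[dual R]_n.
Proof.
by apply/matrixP=> i j; rewrite !mxE rmorph0 mul0r addr0 rmorphMn.
Qed.

Lemma dualmx_eps_scalar (R : realType) (n : nat) (a : R) :
  dualmx 0 a%:M = (eps * a%:D)%:M :> 'M[dual R]_n.
Proof.
by apply/matrixP=> i j; rewrite !mxE rmorph0 add0r rmorphMn /= mulrnAl mulrC.
Qed.

Lemma dualmx_block (R : realType) (m1 m2 n1 n2 : nat)
    (A1 B1 : 'M[R]_(m1, n1)) (A2 B2 : 'M[R]_(m1, n2))
    (A3 B3 : 'M[R]_(m2, n1)) (A4 B4 : 'M[R]_(m2, n2)) :
  dualmx (block_mx A1 A2 A3 A4) (block_mx B1 B2 B3 B4) =
  block_mx (dualmx A1 B1) (dualmx A2 B2)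
           (dualmx A3 B3) (dualmx A4 B4).
Proof.
apply/matrixP=> i j; rewrite mxE.
by case: (split_ordP i) => i' ->; case: (split_ordP j) => j' ->;
  rewrite ?(block_mxEul, block_mxEur, block_mxEdl, block_mxEdr) mxE.
Qed.

Lemma dualmx0 (R : realType) (m n : nat) : dualmx 0 0 = 0 :> 'M[dual R]_(m, n).
Proof. by apply/matrixP=> i j; rewrite !mxE rmorph0 mul0r addr0. Qed.

Lemma dconjmx_tr_mul (R : realType) (m n p : nat) (X : 'M[dual R]_(m, n))
    (Y : 'M[dual R]_(n, p)) :
  (dconjmx (X *m Y))^T = (dconjmx Y)^T *m (dconjmx X)^T.
Proof.
have [A [B ->]] := dualmxP X; have [C [D ->]] := dualmxP Y.
rewrite dualmx_mul !dualmx_conj !dualmx_tr dualmx_mul; congr dualmx.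
  by rewrite trmx_mul.
rewrite [LHS]linearN /= [(_ + _)^T]linearD /= !trmx_mul opprD addrC.
by rewrite ![(- _)^T]linearN /= mulmxN mulNmx.
Qed.

Definition dunitary (R : realType) (n : nat) (U : 'M[dual R]_n) :=
  U *m (dconjmx U)^T = 1%:M.

Lemma dunitary_mul (R : realType) (n : nat) (U V : 'M[dual R]_n) :
  dunitary U -> dunitary V -> dunitary (U *m V).
Proof.
rewrite /dunitary => UU VV.
by rewrite dconjmx_tr_mul mulmxA -(mulmxA U) VV mulmx1.
Qed.

Lemma dunitary_orthogonal (R : realType) (n : nat) (P : 'M[R]_n) :
  P *m P^T = 1%:M -> dunitary (dualmx P 0).
Proof.
move=> PP; rewrite /dunitary dualmx_conj dualmx_tr dualmx_mul PP.
by rewrite oppr0 trmx0 mulmx0 mul0mx addr0 dualmx_scalar rmorph1.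
Qed.

Lemma dunitary_symmetric (R : realType) (n : nat) (K : 'M[R]_n) :
  K^T = K -> dunitary (dualmx 1%:M K).
Proof.
move=> symK; rewrite /dunitary dualmx_conj dualmx_tr dualmx_mul.
by rewrite linearN /= symK trmx1 !mul1mx mulmx1 addNr dualmx_scalar rmorph1.
Qed.

Lemma dunitary_block (R : realType) (m n : nat) (U : 'M[dual R]_m)
    (V : 'M[dual R]_n) :
  dunitary U -> dunitary V -> dunitary (block_mx U 0 0 V).
Proof.
rewrite /dunitary => UU VV.
have d0 p q : dconjmx (0 : 'M[dual R]_(p, q)) = 0.
  by rewrite -dualmx0 dualmx_conj oppr0.
rewrite /dconjmx map_block_mx -!/(dconjmx _) !d0 tr_block_mx !trmx0 mulmx_block.
by rewrite !mulmx0 !mul0mx !addr0 !add0r UU VV -scalar_mx_block.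
Qed.

(** * Assembling block-diagonal matrices *)

Lemma block_diagonal_empty (K : nmodType) (P : forall m : nat, 'M[K]_m -> Prop)
    (A : 'M[K]_0) : block_diagonal P A.
Proof.
exists 0%N, (fun=> 0%N), (fun=> 0), (big_ord0 _ _ _ _).
by split=> [[]|]//; apply/matrixP=> -[].
Qed.

(** Each block is bundled with its size, so that equations between blocks of a priori different
    sizes can be stated and rewritten without casts. *)
Lemma mxdiag_cons (K : nmodType) (k : nat) (b : {m & 'M[K]_m})
    (g : 'I_k -> {m & 'M[K]_m}) (f : 'I_k.+1 -> {m & 'M[K]_m}) :
    f ord0 = b -> (fun i => f (lift ord0 i)) = g ->
  exists e : (\sum_i projT1 (f i) = projT1 b + \sum_i projT1 (g i))%N,
    block_mx (projT2 b) 0 0 (\mxdiag_i projT2 (g i)) =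
    castmx (e, e) (\mxdiag_i projT2 (f i)).
Proof.
move=> <- <-; exists (esym (@mxsize_recl _ (fun i => projT1 (f i)))).
by rewrite mxdiag_recl castmx_comp castmx_id.
Qed.

Lemma block_diagonal_cons (K : nmodType) (P : forall m : nat, 'M[K]_m -> Prop)
    (m n : nat) (B : 'M[K]_m) (A : 'M[K]_n) :
  P m B -> block_diagonal P A -> block_diagonal P (block_mx B 0 0 A).
Proof.
move=> PB [k [p [B' [e [PB' ->]]]]]; case: n / e A.
pose g i := existT (fun m => 'M[K]_m) (p i) (B' i).
pose f i := if unlift ord0 i is Some j then g j
            else existT (fun m => 'M[K]_m) m B.
have f0 : f ord0 = existT _ m B by rewrite /f unlift_none.
have fS : (fun i => f (lift ord0 i)) = g.
  by apply/funext => i; rewrite /f liftK.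
have [e Ee] := mxdiag_cons f0 fS.
exists k.+1, (fun i => projT1 (f i)), (fun i => projT2 (f i)), e; split=> //.
by move=> i; rewrite /f; case: unliftP => [j|] _ /=.
Qed.

(** * Splitting off a block and induction *)

Definition has_dual_svd (R : realType) (n : nat) (M : 'M[dual R]_n) :=
  exists U S V : 'M[dual R]_n,
    [/\ M = U *m S *m (dconjmx V)^T, dunitary U, dunitary V
      & block_diagonal (@svd_block R) S].

Lemma has_dual_svd_mul (R : realType) (n : nat) (X Y M : 'M[dual R]_n) :
  dunitary X -> dunitary Y -> has_dual_svd M ->
  has_dual_svd (X *m M *m (dconjmx Y)^T).
Proof.
move=> uX uY [U [S [V [-> uU uV dS]]]].
exists (X *m U), S, (Y *m V); split=> //; try exact: dunitary_mul.
by rewrite dconjmx_tr_mul !mulmxA.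
Qed.

Lemma has_dual_svd_block (R : realType) (m n : nat) (B : 'M[dual R]_m)
    (M : 'M[dual R]_n) :
  svd_block B -> has_dual_svd M -> has_dual_svd (block_mx B 0 0 M).
Proof.
move=> svdB [U [S [V [-> uU uV dS]]]].
have u1 : dunitary (1%:M : 'M[dual R]_m).
  rewrite -(rmorph1 (@dreal R)) -dualmx_scalar.
  by apply: dunitary_orthogonal; rewrite trmx1 mulmx1.
exists (block_mx 1%:M 0 0 U), (block_mx B 0 0 S), (block_mx 1%:M 0 0 V).
split; try exact: dunitary_block; last exact: block_diagonal_cons.
have d0 p q : dconjmx (0 : 'M[dual R]_(p, q)) = 0.
  by rewrite -dualmx0 dualmx_conj oppr0.
have d1 : dconjmx (1%:M : 'M[dual R]_m) = 1%:M.
  by rewrite -(rmorph1 (@dreal R)) -dualmx_scalar dualmx_conj oppr0.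
rewrite /dconjmx map_block_mx -!/(dconjmx _) !d0 d1 tr_block_mx !trmx0 trmx1.
by rewrite !mulmx_block ?(mulmx0, mul0mx, addr0, add0r) mulmx1 mul1mx.
Qed.

(** Completing [u] and [v] to orthogonal matrices puts [A] and [B] in block form: the action on [v]
    of the transposes kills the lower left blocks, and that on [u] of the matrices the upper right
    ones. *)
Lemma split_block (R : rcfType) (p m : nat) (A B : 'M[R]_(p + m))
    (DA DB : 'M[R]_p) (u v : 'M[R]_(p, p + m)) :
    co_antisymmetric A B -> u *m u^T = 1%:M -> v *m v^T = 1%:M ->
    u *m A = DA *m v -> u *m B = DB *m v ->
    v *m A^T = DA^T *m u -> v *m B^T = DB^T *m u ->
  exists (P Q : 'M[R]_(p + m)) (A' B' : 'M[R]_m),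
    [/\ P *m P^T = 1%:M, Q *m Q^T = 1%:M, co_antisymmetric A' B',
        A = P *m block_mx DA 0 0 A' *m Q^T & B = P *m block_mx DB 0 0 B' *m Q^T].
Proof.
move=> [tAB ABt] uu vv uA uB vA vB.
have [w [ww uw]] := orthonormal_completion (erefl _) uu.
have [x [xx vx]] := orthonormal_completion (erefl _) vv.
pose P := col_mx u w; pose Q := col_mx v x.
have PP : P *m P^T = 1%:M.
  have wu : w *m u^T = 0 by rewrite -[w]trmxK -trmx_mul uw trmx0.
  by rewrite tr_col_mx mul_col_row uu ww uw wu -scalar_mx_block.
have QQ : Q *m Q^T = 1%:M.
  have xv : x *m v^T = 0 by rewrite -[x]trmxK -trmx_mul vx trmx0.
  by rewrite tr_col_mx mul_col_row vv xx vx xv -scalar_mx_block.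
have PtP := mulmx1C PP; have QtQ := mulmx1C QQ.
have blockE C DC : u *m C = DC *m v -> v *m C^T = DC^T *m u ->
    P *m C *m Q^T = block_mx DC 0 0 (w *m C *m x^T).
  move=> uC vC; rewrite mul_col_mx tr_col_mx mul_col_row uC -!mulmxA vv vx.
  rewrite mulmx1 mulmx0; congr block_mx.
  have -> : C *m v^T = (v *m C^T)^T by rewrite trmx_mul trmxK.
  by rewrite vC trmx_mul trmxK mulmxA -[w]trmxK -trmx_mul uw trmx0 mul0mx.
have EA := blockE A DA uA vA; have EB := blockE B DB uB vB.
exists P^T, Q^T, (w *m A *m x^T), (w *m B *m x^T); rewrite !trmxK.
split=> //; last 2 first.
- by rewrite -EA !mulmxA PtP mul1mx -mulmxA QtQ mulmx1.
- by rewrite -EB !mulmxA PtP mul1mx -mulmxA QtQ mulmx1.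
(* Orthogonal changes of basis preserve both antisymmetry relations; their lower right blocks are
   the relations for [A'] and [B']. *)
have tblock C D : (P *m C *m Q^T)^T *m (P *m D *m Q^T) = Q *m (C^T *m D) *m Q^T.
  by rewrite !trmx_mul trmxK !mulmxA -(mulmxA _ P^T P) PtP mulmx1.
have blockt C D : (P *m C *m Q^T) *m (P *m D *m Q^T)^T = P *m (C *m D^T) *m P^T.
  by rewrite !trmx_mul trmxK !mulmxA -(mulmxA _ Q^T Q) QtQ mulmx1.
split.
  have := tblock A B; rewrite tAB mulmxN mulNmx -tblock EA EB !tr_block_mx.
  rewrite !mulmx_block opp_block_mx => /(congr1 drsubmx).
  by rewrite !block_mxKdr !trmx0 !mul0mx !add0r.
have := blockt A B; rewrite ABt mulmxN mulNmx -blockt EA EB !tr_block_mx.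
rewrite !mulmx_block opp_block_mx => /(congr1 drsubmx).
by rewrite !block_mxKdr !trmx0 !mul0mx !add0r.
Qed.

Lemma orthonormal_leq (R : fieldType) (p n : nat) (u : 'M[R]_(p, n)) :
  u *m u^T = 1%:M -> (p <= n)%N.
Proof.
move=> uu; rewrite -(mxrank1 R p) -uu.
exact: leq_trans (mxrankM_maxl _ _) (rank_leq_col _).
Qed.

Lemma has_dual_svd_co_antisymmetric (R : realType) (n : nat) (A B : 'M[R]_n) :
  co_antisymmetric A B -> has_dual_svd (dualmx A B).
Proof.
have [k] := ubnP n; elim: k n A B => // k IH n A B nk coAB.
case: (posnP n) => [n0|n_gt0].
  subst n; exists 1%:M, (dualmx A B), 1%:M.
  by split; try (by apply/matrixP => -[]); exact: block_diagonal_empty.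
(* This common form covers both outcomes of [exists_block], with [p] equal to 1 or 2. *)
suff [p [DA [DB [u [v [p_gt0 svdD [uu vv] [uA uB] [vA vB]]]]]]] :
  exists p (DA DB : 'M[R]_p) (u v : 'M[R]_(p, n)),
    [/\ (0 < p)%N, svd_block (dualmx DA DB),
        u *m u^T = 1%:M /\ v *m v^T = 1%:M,
        u *m A = DA *m v /\ u *m B = DB *m v
      & v *m A^T = DA^T *m u /\ v *m B^T = DB^T *m u].
  have np : n = (p + (n - p))%N by rewrite subnKC // (orthonormal_leq uu).
  move: (n - p)%N np => m np; subst n.
  have [P [Q [A' [B' [PP QQ coAB' -> ->]]]]] :=
    split_block coAB uu vv uA uB vA vB.
  have -> : dualmx (P *m block_mx DA 0 0 A' *m Q^T)
                         (P *m block_mx DB 0 0 B' *m Q^T)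
    = dualmx P 0 *m block_mx (dualmx DA DB) 0 0 (dualmx A' B')
      *m (dconjmx (dualmx Q 0))^T.
    rewrite -(dualmx0 R p m) -(dualmx0 R m p).
    rewrite -dualmx_block dualmx_conj dualmx_tr !dualmx_mul oppr0 trmx0.
    by rewrite mul0mx addr0 mulmx0 add0r.
  apply: has_dual_svd_mul; try exact: dunitary_orthogonal.
  apply: has_dual_svd_block => //; apply: IH => //.
  by rewrite -ltnS (leq_trans _ nk) // ltnS -[X in (X < _)%N]add0n ltn_add2r.
have [[a [b [u [v [[uu vv] ab [uA uB] [vA vB]]]]]]|] :=
    exists_block n_gt0 coAB.
  exists 1%N, a%:M, b%:M, u, v; rewrite !tr_scalar_mx !mul_scalar_mx; split=> //.
  case: ab => [->|->]; last first.
    by rewrite raddf0 dualmx_scalar; exact: SvdReal.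
  (* When both values vanish, the block is the real block 0, since [SvdEps] demands a nonzero
     coefficient. *)
  have [->|b0] := eqVneq b 0.
    by rewrite [X in dualmx _ X]raddf0 dualmx_scalar; exact: SvdReal.
  by rewrite raddf0 dualmx_eps_scalar; exact: SvdEps.
move=> [a [b [u [w [v [x [[b0 uu ww uw] [vv xx vx] [uA wA uB wB] [vA xA vB xB]]]]]]]].
exists (1 + 1)%N, (block_mx a%:M 0 0 a%:M), (block_mx 0 (- b)%:M b%:M 0).
exists (col_mx u w), (col_mx v x).
split=> //.
- rewrite dualmx_block !dualmx_scalar !dualmx_eps_scalar rmorphN mulrN.
  exact: SvdTwin.
- have wu : w *m u^T = 0 by rewrite -[w]trmxK -trmx_mul uw trmx0.
  have xv : x *m v^T = 0 by rewrite -[x]trmxK -trmx_mul vx trmx0.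
  by rewrite !tr_col_mx !mul_col_row uu ww uw wu vv xx vx xv -!scalar_mx_block.
- rewrite !mul_block_col !mul_col_mx !mul_scalar_mx !mul0mx ?add0r ?addr0.
  by rewrite uA wA uB wB.
- rewrite !tr_block_mx !mul_block_col !mul_col_mx !tr_scalar_mx !trmx0.
  by rewrite !mul_scalar_mx !mul0mx ?add0r ?addr0 vA xA vB xB.
Qed.

Unset Implicit Arguments.

Theorem mainTheorem2 (R : realType) (n : nat) (hn : (0 < n)%N)
    (M : 'M[dual R]_n) :
  exists U S V : 'M[dual R]_n,
    [/\ M = U *m S *m (dconjmx V)^T,
        U *m (dconjmx U)^T = 1%:M,
        V *m (dconjmx V)^T = 1%:M
      & block_diagonal (@svd_block R) S].
Proof.
have [A [B ->]] := dualmxP M.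
have [K [L [symK symL tAC ACt]]] := symmetric_reduction A B.
set C := _ - _ in tAC ACt.
(* The reduction is undone by inverses: [1 - K eps] inverts [1 + K eps], and the conjugate transpose
   of [1 - L eps] is [1 + L eps]. *)
have -> : dualmx A B = dualmx 1%:M (- K) *m dualmx A C
    *m (dconjmx (dualmx 1%:M (- L)))^T.
  rewrite dualmx_conj dualmx_tr !dualmx_mul opprK trmx1 symL !mul1mx !mulmx1.
  by rewrite mulNmx /C addrC [_ - _ - _]addrAC addrK subrK.
apply: has_dual_svd_mul; try by apply: dunitary_symmetric; rewrite linearN /= ?symK ?symL.
exact: has_dual_svd_co_antisymmetric.
Qed.
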